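(* Let $n\ge 1$ and $k,l\ge 0$ be integers. There is a basis of $\operatorname{Hom}_{S_n}(S^k(\mathbb{R}^n),S^l(\mathbb{R}^n))$ that corresponds bijectively with the $(k,l)$-bipartitions having at most $n$ blocks, namely the orbit basis $\{X_\pi\}$, where $\pi$ ranges over the $(k,l)$-bipartitions having at most $n$ blocks. Consequently, the dimension of $\operatorname{Hom}_{S_n}(S^k(\mathbb{R}^n),S^l(\mathbb{R}^n))$ equals $p_n(k,l)$, the number of $(k,l)$-bipartitions having at most $n$ blocks.
   Context: $[n]=\{1,\dots,n\}$. $S[n]^k$ is the set of weakly increasing $k$-tuples with entries in $[n]$ (for $k=0$, only the empty tuple). $S^k(\mathbb{R}^n)$ is the real vector space with standard basis $\{e_I\}$ indexed by $I\in S[n]^k$, with the $S_n$-representation $\rho_k^S(\sigma)e_I=e_{\operatorname{sort}(\sigma(I))}$, where $\sigma$ is applied entrywise and $\operatorname{sort}$ rearranges a tuple into weakly increasing order. $\operatorname{Hom}_{S_n}(S^k(\mathbb{R}^n),S^l(\mathbb{R}^n))$ is the vector space of linear maps $g$ with $g(\rho_k^S(\sigma)v)=\rho_l^S(\sigma)g(v)$ for all $\sigma\in S_n$, $v\in S^k(\mathbb{R}^n)$; linear maps are identified with their matrices in the standard bases. For $I\in S[n]^l$, $J\in S[n]^k$, $E_{I,J}$ is the matrix unit with $1$ in position $(I,J)$ and $0$ elsewhere. A $(k,l)$-bipartition with $t$ blocks is a multiset $\{[x_1,y_1],\dots,[x_t,y_t]\}$ of $t$ pairs of non-negative integers, $x_i,y_i$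 not both zero, with $\sum_i x_i=k$ and $\sum_i y_i=l$ (for $k=l=0$ the only one is empty). The type of $(I,J)\in S[n]^l\times S[n]^k$ is the $(k,l)$-bipartition whose blocks are the pairs $[x_a,y_a]$, one for each $a\in[n]$ appearing in $I$ or $J$, with $x_a$ (resp. $y_a$) the number of occurrences of $a$ in $J$ (resp. $I$). For a $(k,l)$-bipartition $\pi$ with at most $n$ blocks, $X_\pi$ is the sum of all $E_{I,J}$ with $(I,J)$ of type $\pi$. *)

(* Defs.v *)
From HB Require Import structures.
From mathcomp Require Import all_boot all_order all_algebra all_fingroup.
From mathcomp Require Import finmap multiset.
From mathcomp Require Import reals.

Set Implicit Arguments.
Unset Strict Implicit.
Unset Printing Implicit Defensive.

Import Order.TTheory GRing.Theory.

Local Open Scope mset_scope.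
Local Open Scope ring_scope.

(* [n] is represented by 'I_n = {0, .., n - 1}. *)
Record symtuple (n k : nat) := Symtuple {
  symtuple_val :> k.-tuple 'I_n;
  _ : sorted <=%O symtuple_val
}.

HB.instance Definition _ n k := [isSub for @symtuple_val n k].
HB.instance Definition _ n k := [Finite of symtuple n k by <:].

Lemma sort_map_sorted n k (s : 'S_n) (I : symtuple n k) :
  sorted <=%O [tuple of sort <=%O (map s I)].
Proof. exact/sort_sorted/le_total. Qed.

Definition symtuple_act n k (s : 'S_n) (I : symtuple n k) : symtuple n k :=
  Symtuple (sort_map_sorted s I).

Section Hom.
Variables (F : fieldType) (n : nat).

(* S^k(F^n), with coordinates indexed by symtuple n k via enum_rank. *)
Definition sympow (k : nat) := 'cV[F]_#|{: symtuple n k}|.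

Definition sympow_basis k (I : symtuple n k) : sympow k :=
  delta_mx (enum_rank I) 0.

Definition sympow_rho_fun k (s : 'S_n) (v : sympow k) : sympow k :=
  \sum_(I : symtuple n k)
     v (enum_rank I) 0 *: sympow_basis (symtuple_act s I).

Lemma sympow_rho_fun_linear k s : linear (@sympow_rho_fun k s).
Proof.
move=> a u v; rewrite /sympow_rho_fun scaler_sumr -big_split /=.
by apply: eq_bigr => I _; rewrite !mxE scalerDl scalerA.
Qed.

HB.instance Definition _ k s :=
  GRing.isLinear.Build F (sympow k) (sympow k) _ (@sympow_rho_fun k s)
    (@sympow_rho_fun_linear k s).

Definition sympow_rho k (s : 'S_n) : 'End(sympow k) :=
  linfun (@sympow_rho_fun k s).

Lemma sympow_rhoE k s (I : symtuple n k) :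
  sympow_rho k s (sympow_basis I) = sympow_basis (symtuple_act s I).
Proof.
rewrite lfunE /= /sympow_rho_fun (bigD1 I) //= !mxE !eqxx scale1r.
rewrite big1 ?addr0 // => J JI.
by rewrite !mxE (inj_eq enum_rank_inj) (negPf JI) scale0r.
Qed.

Variables k l : nat.

Definition equivariance_defect (s : 'S_n) (g : 'Hom(sympow k, sympow l)) :
    'Hom(sympow k, sympow l) :=
  (g \o sympow_rho k s)%VF - (sympow_rho l s \o g)%VF.

Lemma equivariance_defect_linear s : linear (equivariance_defect s).
Proof.
move=> a f g; apply/lfunP => v; rewrite /equivariance_defect.
rewrite !(add_lfunE, opp_lfunE, scale_lfunE, comp_lfunE) linearD linearZ /=.
by rewrite scalerBr opprD addrACA.
Qed.

HB.instance Definition _ s :=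
  GRing.isLinear.Build F 'Hom(sympow k, sympow l) 'Hom(sympow k, sympow l) _
    (equivariance_defect s) (equivariance_defect_linear s).

Definition HomSn : {vspace 'Hom(sympow k, sympow l)} :=
  (\bigcap_(s : 'S_n) lker (linfun (equivariance_defect s)))%VS.

Lemma memHomSn (g : 'Hom(sympow k, sympow l)) :
  g \in HomSn <->
  forall (s : 'S_n) (v : sympow k),
    g (sympow_rho k s v) = sympow_rho l s (g v).
Proof.
rewrite memvE; split=> [/subv_bigcapP gH s v | gH].
  have := gH s isT; rewrite -memvE memv_ker lfunE /= subr_eq0 => /eqP.
  by move/lfunP/(_ v); rewrite !comp_lfunE.
apply/subv_bigcapP => s _; rewrite -memvE memv_ker lfunE /= subr_eq0.
by apply/eqP/lfunP => v; rewrite !comp_lfunE.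
Qed.

Definition mx_hom (A : 'M[F]_(#|{: symtuple n l}|, #|{: symtuple n k}|)) :
    'Hom(sympow k, sympow l) :=
  linfun (mulmx A : sympow k -> sympow l).

Lemma mx_homE A (v : sympow k) : mx_hom A v = A *m v.
Proof. by rewrite lfunE. Qed.

End Hom.

(* A {mset _} coerces to the sequence of its elements repeated according to
   multiplicity, so the sums below are multiset sums. *)
Definition is_bipartition (k l : nat) (pi : {mset nat * nat}) : bool :=
  [&& all (fun b => b != (0, 0)%N) pi,
      (\sum_(b <- pi) b.1)%N == k
    & (\sum_(b <- pi) b.2)%N == l].

Record bipartition (k l : nat) := Bipartition {
  bipartition_val :> {mset nat * nat};
  _ : is_bipartition k l bipartition_val
}.

HB.instance Definition _ k l := [isSub for @bipartition_val k l].
HB.instance Definition _ k l := [Choice of bipartition k l by <:].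

Definition nblocks k l (pi : bipartition k l) : nat :=
  size (enum_mset (bipartition_val pi)).

Section BipartitionFinite.
Variables k l : nat.

Definition bipartition_code (pi : bipartition k l) :
    (k + l).-bseq ('I_k.+1 * 'I_l.+1)%type :=
  insub_bseq (k + l) [seq (inord b.1, inord b.2) | b <- enum_mset pi].

Definition bipartition_decode (s : (k + l).-bseq ('I_k.+1 * 'I_l.+1)%type) :
    option (bipartition k l) :=
  insub (seq_mset [seq (val b.1, val b.2) | b <- s]).

Lemma size_blocks_le (s : seq (nat * nat)) :
  all (fun b => b != (0, 0)%N) s ->
  (size s <= \sum_(b <- s) b.1 + \sum_(b <- s) b.2)%N.
Proof.
elim: s => [|[x y] s IHs] //= /andP[xy0 /IHs le_s].
rewrite !big_cons /= addnACA -add1n leq_add //.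
by move: x y xy0 {le_s} => [|x] [|y].
Qed.

Lemma bipartition_codeK : pcancel bipartition_code bipartition_decode.
Proof.
move=> pi; have /and3P[nz /eqP sk /eqP sl] := valP pi.
rewrite /bipartition_decode /bipartition_code /insub_bseq insubdK; last first.
  rewrite unfold_in size_map.
  by rewrite -[X in (_ <= X + _)%N]sk -[X in (_ <= _ + X)%N]sl size_blocks_le.
rewrite -map_comp (_ : map _ _ = enum_mset pi) ?seq_mset_id ?valK //.
rewrite -[RHS]map_id; apply/eq_in_map => -[x y] pixy /=.
have le_xk : (x <= k)%N by rewrite -sk (big_rem _ pixy) leq_addr.
have le_yl : (y <= l)%N by rewrite -sl (big_rem _ pixy) leq_addr.
by rewrite !inordK.
Qed.

End BipartitionFinite.

HB.instance Definition _ k l : isCountable (bipartition k l) :=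
  PCanIsCountable (@bipartition_codeK k l).
HB.instance Definition _ k l : isFinite (bipartition k l) :=
  PCanIsFinite (@bipartition_codeK k l).

Definition symtuple_blocks n k l (I : symtuple n l) (J : symtuple n k) :
    {mset nat * nat} :=
  seq_mset [seq (count_mem a J, count_mem a I)
           | a <- enum 'I_n & (a \in val I) || (a \in val J)].

Lemma symtuple_blocks_bipartition n k l (I : symtuple n l) (J : symtuple n k) :
  is_bipartition k l (symtuple_blocks I J).
Proof.
have sumE m (s : symtuple n m) (P : pred 'I_n) : {subset (s : seq _) <= P} ->
    (\sum_(a <- enum 'I_n | P a) count_mem a s)%N = m.
  move=> sP; rewrite big_enum_cond /= -[RHS](size_tuple s) -sum1_size.
  rewrite (eq_bigr (fun a => \sum_(x <- s | x == a) 1)%N); last first.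
    by move=> a _; rewrite sum1_count.
  rewrite (exchange_big_dep predT) //= big_seq [RHS]big_seq.
  apply: eq_bigr => x xs; rewrite (big_pred1 x) // => a /=.
  by rewrite eq_sym; case: eqP => [->|]; rewrite ?andbF // andbT; apply: sP.
have pE := perm_eq_seq_mset [seq (count_mem a J, count_mem a I)
           | a <- enum 'I_n & (a \in val I) || (a \in val J)].
apply/and3P; split.
- rewrite (perm_all _ pE) all_map; apply/allP => a; rewrite mem_filter.
  case/andP=> aIJ _ /=; rewrite xpair_eqE negb_and -!lt0n -!has_count.
  by rewrite !has_pred1 orbC.
- rewrite (perm_big _ pE) /= big_map big_filter /= sumE // => a aJ.
  by apply/orP; right.
- rewrite (perm_big _ pE) /= big_map big_filter /= sumE // => a aI.
  by apply/orP; left.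
Qed.

Definition symtuple_type n k l (I : symtuple n l) (J : symtuple n k) :
    bipartition k l :=
  Bipartition (symtuple_blocks_bipartition I J).

Definition matrix_unit (F : fieldType) n k l
    (I : symtuple n l) (J : symtuple n k) :
    'M[F]_(#|{: symtuple n l}|, #|{: symtuple n k}|) :=
  delta_mx (enum_rank I) (enum_rank J).

(* The matrix is 0 when pi has more than n blocks. *)
Definition orbit_mx (F : fieldType) n k l (pi : bipartition k l) :
    'M[F]_(#|{: symtuple n l}|, #|{: symtuple n k}|) :=
  \sum_(I : symtuple n l)
    \sum_(J : symtuple n k | symtuple_type I J == pi) matrix_unit F I J.

Definition bipartitions_upto n k l : {set bipartition k l} :=
  [set pi | (nblocks pi <= n)%N].

Definition num_bipartitions n k l : nat := #|bipartitions_upto n k l|.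

(* Main.v *)
(* The matrix of an equivariant map is constant on the orbits of the diagonal
   action of S_n on pairs (I, J).  A pair amounts to the family of pairs of
   multiplicities of each a in [n], and S_n permutes that family, so the orbit
   is the multiset of these pairs; dropping the zero pairs (whose number is n
   minus the number of blocks) gives exactly the type of (I, J). *)
Require Import Defs.
From mathcomp Require Import all_boot all_order all_algebra all_fingroup.
From mathcomp Require Import finmap multiset.
From mathcomp Require Import reals.
Local Open Scope ring_scope.

Set Implicit Arguments.
Unset Strict Implicit.
Unset Printing Implicit Defensive.

Import Order.TTheory GRing.Theory.

(** * Weakly increasing tuples as multiplicity functions *)

Lemma symtuple_countP n k (I J : symtuple n k) :
  (forall a, count_mem a I = count_mem a J) -> I = J.
Proof.
move=> IJ; apply/val_inj/val_inj => /=.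
apply: (sorted_eq (leT := <=%O)).
- exact: le_trans.
- exact: le_anti.
- exact: valP I.
- exact: valP J.
- by apply/allP => a _ /=; rewrite IJ.
Qed.

Lemma count_symtuple_act n k (s : 'S_n) (I : symtuple n k) a :
  count_mem (s a) (symtuple_act s I) = count_mem a I.
Proof.
rewrite /= (seq.permP (permEl (perm_sort _ _))) count_map.
by apply: eq_count => b /=; rewrite (inj_eq perm_inj).
Qed.

Lemma symtuple_actK n k (s : 'S_n) :
  cancel (@symtuple_act n k s) (@symtuple_act n k s^-1%g).
Proof.
move=> I; apply: symtuple_countP => a.
by rewrite -[a in LHS](permK s) !count_symtuple_act.
Qed.

Lemma symtuple_actVK n k (s : 'S_n) :
  cancel (@symtuple_act n k s^-1%g) (@symtuple_act n k s).
Proof. by move=> I; have := symtuple_actK s^-1%g I; rewrite invgK. Qed.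

(** Concatenate [f a] copies of each [a] and sort; the length is the sum of [f]. *)
Lemma symtuple_of_counts n k (f : 'I_n -> nat) :
  (\sum_a f a)%N = k -> exists I : symtuple n k, forall a, count_mem a I = f a.
Proof.
move=> sum_f; pose t := flatten [seq nseq (f a) a | a <- enum 'I_n].
have szt : size (sort <=%O t) == k.
  rewrite size_sort size_flatten /shape -map_comp sumnE big_map -sum_f.
  by rewrite big_enum; apply/eqP/eq_bigr => a _ /=; rewrite size_nseq.
exists (Symtuple (symtuple_val := Tuple szt) (sort_sorted (@le_total _ _) t)).
move=> a; rewrite /= (seq.permP (permEl (perm_sort _ _))) count_flatten -map_comp.
rewrite sumnE big_map big_enum (bigD1 a) //= count_nseq /= eqxx mul1n.
by rewrite big1 ?addn0 // => b ba; rewrite count_nseq /= (negPf ba).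
Qed.

(** * Types as families of multiplicity pairs up to permutation *)

Definition mult_pairs n k l (I : symtuple n l) (J : symtuple n k) :
    n.-tuple (nat * nat) :=
  [tuple (count_mem a J, count_mem a I) | a < n].

Lemma symtuple_blocksE n k l (I : symtuple n l) (J : symtuple n k) :
  symtuple_blocks I J = seq_mset [seq b <- mult_pairs I J | b != (0, 0)%N].
Proof.
rewrite /symtuple_blocks /mult_pairs /= filter_map; congr (seq_mset (map _ _)).
apply: eq_filter => a /=; rewrite xpair_eqE negb_and -!lt0n -!has_count.
by rewrite !has_pred1 orbC.
Qed.

(** The common size determines how many copies of [z] were removed, so filtering loses nothing. With
    [z] the zero pair, this lets types be compared through families of fixed length [n]. *)
Lemma perm_filter_nonzero (T : eqType) (z : T) (s t : seq T) :
    size s = size t ->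
  perm_eq [seq b <- s | b != z] [seq b <- t | b != z] = perm_eq s t.
Proof.
move=> st; apply/idP/idP => [pst|]; last exact: perm_filter.
have pz (u : seq T) : perm_eq u
    ([seq b <- u | b != z] ++ nseq (size u - size [seq b <- u | b != z]) z).
  rewrite -(permPl (permEl (perm_filterC (fun b => b != z) u))) perm_cat2l.
  rewrite (_ : filter (predC _) u = filter (pred1 z) u); last first.
    by apply: eq_filter => b /=; rewrite negbK.
  rewrite size_filter -(count_predC (fun b => b != z) u) addKn.
  rewrite (eq_count (a2 := pred1 z)) => [|b /=]; last by rewrite negbK.
  rewrite -size_filter.
  by rewrite (all_pred1P _ _ (filter_all (pred1 z) u)) size_nseq.
rewrite (permPl (pz s)) perm_sym (permPl (pz t)) st (perm_size pst).
by rewrite perm_cat2r perm_sym.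
Qed.

Lemma symtuple_type_eqE n k l (I I' : symtuple n l) (J J' : symtuple n k) :
  (symtuple_type I J == symtuple_type I' J')
    = perm_eq (mult_pairs I J) (mult_pairs I' J').
Proof.
rewrite -val_eqE /= !symtuple_blocksE -(perm_filter_nonzero (0, 0)%N).
  apply/eqP/idP => [e | p].
    rewrite -(permPl (perm_eq_seq_mset _)) e; exact: perm_eq_seq_mset.
  exact/eq_seq_msetP.
by rewrite !size_tuple.
Qed.

Lemma symtuple_type_act n k l s (I : symtuple n l) (J : symtuple n k) :
  symtuple_type (symtuple_act s I) (symtuple_act s J) = symtuple_type I J.
Proof.
apply/eqP; rewrite symtuple_type_eqE perm_sym; apply/tuple_permP; exists s.
congr val; apply: eq_from_tnth => a.
by rewrite !tnth_mktuple !count_symtuple_act.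
Qed.

(** Equal types make the two families of pairs rearrangements of each other. Since the pairs are
    indexed by the letters, the rearrangement is itself an element of ['S_n], and it moves both
    tuples at once. *)
Lemma symtuple_type_orbit n k l (I I' : symtuple n l) (J J' : symtuple n k) :
    symtuple_type I J = symtuple_type I' J' ->
  exists s, I = symtuple_act s I' /\ J = symtuple_act s J'.
Proof.
move/esym/eqP; rewrite symtuple_type_eqE => /tuple_permP[s /val_inj e].
have cE a : (count_mem a J', count_mem a I')
            = (count_mem (s a) J, count_mem (s a) I).
  have := congr1 (fun t => tnth t a) e.
  by rewrite !tnth_mktuple.
exists s; split; apply: symtuple_countP => a; rewrite -[a](permKV s);
  by rewrite count_symtuple_act; case: (cE (s^-1 a)%g).
Qed.

Lemma symtuple_type_upto n k l (I : symtuple n l) (J : symtuple n k) :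
  symtuple_type I J \in bipartitions_upto n k l.
Proof.
rewrite inE /nblocks /= symtuple_blocksE (perm_size (perm_eq_seq_mset _)).
by rewrite size_filter (leq_trans (count_size _ _)) // size_tuple.
Qed.

(** Distribute the blocks of [pi] over the letters in any order, give the remaining letters the zero
    pair, and read the pairs as multiplicities. *)
Lemma symtuple_type_surj n k l (pi : bipartition k l) :
  pi \in bipartitions_upto n k l ->
  exists p : symtuple n l * symtuple n k, symtuple_type p.1 p.2 = pi.
Proof.
rewrite inE => le_pi_n; have /and3P[nz /eqP sk /eqP sl] := valP pi.
pose t := enum_mset pi ++ nseq (n - nblocks pi) (0, 0)%N.
have szt : size t == n by rewrite size_cat size_nseq subnKC.
pose b a := tnth (Tuple szt) a.
(* The padding does not change the coordinate sums, so the tuples have lengths [l] and [k]. *)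
have sumE (f : nat * nat -> nat) : f (0, 0)%N = 0%N ->
    (\sum_(a < n) f (b a) = \sum_(x <- enum_mset pi) f x)%N.
  move=> f0; rewrite -(big_tuple _ _ (Tuple szt) xpredT f) /= big_cat /=.
  by rewrite [X in (_ + X)%N]big_nseq iter_addn f0 mul0n !addn0.
have [I cI] := symtuple_of_counts (etrans (sumE snd erefl) sl).
have [J cJ] := symtuple_of_counts (etrans (sumE fst erefl) sk).
exists (I, J); apply/val_inj; rewrite /= symtuple_blocksE.
have -> : mult_pairs I J = Tuple szt.
  apply: eq_from_tnth => a; rewrite tnth_mktuple cI cJ -/(b a).
  by case: (b a).
rewrite /= filter_cat (all_filterP nz) filter_nseq /= cats0.
exact: seq_mset_id.
Qed.

(** * Matrix coefficients and the orbit basis *)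

Section Coefficients.
Variables (F : fieldType) (n k l : nat).
Implicit Types (g : 'Hom(sympow F n k, sympow F n l)) (pi : bipartition k l).

Definition hom_coef g (I : symtuple n l) (J : symtuple n k) : F :=
  g (sympow_basis F J) (enum_rank I) 0.

Lemma sympow_sum_basis m (v : sympow F n m) :
  v = \sum_(I : symtuple n m) v (enum_rank I) 0 *: sympow_basis F I.
Proof.
apply/colP => i; rewrite summxE (bigD1 (enum_val i)) //= !mxE enum_valK !eqxx.
rewrite mulr1 big1 ?addr0 // => I Ii.
by rewrite !mxE -(inj_eq enum_val_inj) enum_rankK eq_sym (negPf Ii) mulr0.
Qed.

Lemma hom_coef_inj g g' : (forall I J, hom_coef g I J = hom_coef g' I J) -> g = g'.
Proof.
move=> gg'; apply/lfunP => v; rewrite [v]sympow_sum_basis !linear_sum.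
apply: eq_bigr => J _; rewrite !linearZ; congr (_ *: _); apply/colP => i.
by rewrite -[i]enum_valK; apply: gg'.
Qed.

Lemma hom_coef_sum (T : Type) (r : seq T) (P : pred T) c
    (f : T -> 'Hom(sympow F n k, sympow F n l)) I J :
  hom_coef (\sum_(t <- r | P t) c t *: f t) I J
    = \sum_(t <- r | P t) c t * hom_coef (f t) I J.
Proof.
rewrite /hom_coef sum_lfunE summxE; apply: eq_bigr => t _.
by rewrite scale_lfunE mxE.
Qed.

Lemma hom_coef_orbit pi I J :
  hom_coef (mx_hom (orbit_mx F n pi)) I J = (symtuple_type I J == pi)%:R.
Proof.
rewrite /hom_coef mx_homE /sympow_basis -colE mxE /orbit_mx summxE.
rewrite (bigD1 I) //= summxE [X in _ + X]big1 ?addr0 => [|I' I'I]; last first.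
  rewrite summxE big1 // => J' _.
  by rewrite mxE (inj_eq enum_rank_inj) eq_sym (negPf I'I).
rewrite big_mkcond (bigD1 J) //= big1 ?addr0 => [|J' J'J].
  by case: eqP => // _; rewrite mxE !eqxx.
by case: ifP => // _; rewrite mxE !(inj_eq enum_rank_inj) [J == _]eq_sym (negPf J'J) andbF.
Qed.

(** The action of [s] is injective on indices, so no two basis vectors merge and coordinates are
    only relabelled. *)
Lemma sympow_rho_coef m s (v : sympow F n m) I :
  sympow_rho F m s v (enum_rank (symtuple_act s I)) 0 = v (enum_rank I) 0.
Proof.
rewrite lfunE /= /sympow_rho_fun summxE (bigD1 I) //= !mxE !eqxx mulr1.
rewrite big1 ?addr0 // => J JI.
rewrite !mxE (inj_eq enum_rank_inj) (can_eq (symtuple_actK s)) eq_sym.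
by rewrite (negPf JI) mulr0.
Qed.

Lemma memHomSn_coef g :
  g \in HomSn F n k l <->
  forall s I J, hom_coef g (symtuple_act s I) (symtuple_act s J) = hom_coef g I J.
Proof.
rewrite memHomSn; split=> [gH s I J | gH s v].
  by rewrite /hom_coef -sympow_rhoE gH sympow_rho_coef.
rewrite [v]sympow_sum_basis !linear_sum; apply: eq_bigr => J _.
rewrite !linearZ /=; congr (_ *: _); apply/colP => i.
(* Every row index has the form [symtuple_act s I], so invariance of the coefficients applies. *)
rewrite -[i]enum_valK -[enum_val i](symtuple_actVK s) sympow_rho_coef.
by rewrite sympow_rhoE; apply: gH.
Qed.

Lemma orbit_in_HomSn pi : mx_hom (orbit_mx F n pi) \in HomSn F n k l.
Proof. by apply/memHomSn_coef => s I J; rewrite !hom_coef_orbit symtuple_type_act. Qed.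

(** The orbit matrices are 0-1 matrices with disjoint supports: evaluating a vanishing combination
    at a pair of type [pi] isolates the coefficient of [pi]. The bound on blocks provides such a
    pair. *)
Lemma orbit_free :
  free [seq mx_hom (orbit_mx F n pi) | pi : bipartition k l in bipartitions_upto n k l].
Proof.
pose f pi := mx_hom (orbit_mx F n pi).
apply/(freeP (X := image_tuple f (mem (bipartitions_upto n k l)))) => c c0 i.
have [[I J] /= IJ] := symtuple_type_surj (enum_valP i).
have /esym := congr1 (fun g => hom_coef g I J) c0.
rewrite hom_coef_sum (bigD1 i) //= nth_image hom_coef_orbit IJ eqxx mulr1.
rewrite big1 ?addr0 => [<-|j ji]; first by rewrite /hom_coef zero_lfunE mxE.
by rewrite nth_image hom_coef_orbit IJ (inj_eq enum_val_inj) eq_sym (negPf ji) mulr0.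
Qed.

Lemma orbit_span :
  (<<[seq mx_hom (orbit_mx F n pi) | pi : bipartition k l in bipartitions_upto n k l]>>
     = HomSn F n k l)%VS.
Proof.
apply/eqP; rewrite eqEsubv; apply/andP; split.
  by apply/span_subvP => _ /imageP[pi _ ->]; apply: orbit_in_HomSn.
apply/subvP => g /memHomSn_coef gH.
(* The coefficient of [pi] is the entry of [g] at an arbitrary pair of type [pi]; the default 0 is
   taken only if no such pair exists. *)
pose c pi : F :=
  if [pick p : symtuple n l * symtuple n k | symtuple_type p.1 p.2 == pi]
    is Some p then hom_coef g p.1 p.2 else 0.
have -> : g = \sum_(pi in bipartitions_upto n k l) c pi *: mx_hom (orbit_mx F n pi).
  apply: hom_coef_inj => I J; rewrite hom_coef_sum.
  rewrite (bigD1 (symtuple_type I J)) ?symtuple_type_upto //=.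
  rewrite hom_coef_orbit eqxx mulr1 big1 ?addr0 => [|pi /andP[_ ne]]; last first.
    by rewrite hom_coef_orbit eq_sym (negPf ne) mulr0.
  rewrite /c; case: pickP => [[I' J'] /= /eqP e | /(_ (I, J))]; last by rewrite eqxx.
  (* The picked pair lies in the orbit of [(I, J)], where [g] has constant entries. *)
  by have [s [-> ->]] := symtuple_type_orbit e; rewrite gH.
by apply: memv_suml => pi pin; apply/memvZ/memv_span/image_f.
Qed.

End Coefficients.

Theorem theorem4p8 (R : realType) (n k l : nat) (hn : (1 <= n)%N) :
  [/\ {in bipartitions_upto n k l &,
         injective (fun pi : bipartition k l => mx_hom (orbit_mx R n pi))},
      basis_of (HomSn R n k l)
        [seq mx_hom (orbit_mx R n pi) | pi : bipartition k l in bipartitions_upto n k l]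
    & \dim (HomSn R n k l) = num_bipartitions n k l].
Proof.
split.
(* A free family has no repeated member, which is injectivity on the index set. *)
- apply/dinjectiveP; exact: free_uniq (orbit_free R n k l).
- by rewrite basisEfree orbit_free orbit_span subvv -orbit_span dim_span.
- by rewrite -orbit_span (eqP (orbit_free R n k l)) size_image.
Qed.
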